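(* Every central rooted random ballot path $M$ with law $\nu_M$ is a mixing of the Markov chains $M^{\lambda}$, $\lambda\in[1/2,1]$; that is, there is a probability measure $\mu$ on $[1/2,1]$ such that $$\nu_M=\int_{1/2}^1\nu_\lambda\,d\mu(\lambda),$$ where $\nu_\lambda$ denotes the law of $M^\lambda$.
   Context: A (rooted, infinite) ballot path is an infinite lattice path in $\mathbb{N}\times\mathbb{N}$ ($0\in\mathbb{N}$) starting at $(0,0)$ and taking only steps $(1,1)$ and $(1,-1)$. A rooted random ballot path is a probability measure (equivalently, a random variable with that law) on the space of infinite rooted ballot paths with the $\sigma$-algebra generated by cylinder sets. It is central if, for every lattice point $(n,k)$, conditionally on the random path passing through $(n,k)$, its initial segment is uniformly distributed on the set of ballot paths from $(0,0)$ to $(n,k)$. For $\lambda\in(1/2,1]$, $M^\lambda$ is the Markov chain on infinite rooted ballot paths, started at $(0,0)$, with transition probabilities $$p_\lambda((m,s),(m+1,s+1))=\frac{(1-\lambda)^{s+2}-\lambda^{s+2}}{(1-\lambda)^{s+1}-\lambda^{s+1}},\qquad p_\lambda((m,s),(m+1,s-1))=1-\frac{(1-\lambda)^{s+2}-\lambda^{s+2}}{(1-\lambda)^{s+1}-\lambda^{s+1}}.$$ For $\lambda=1/2$, $M^{1/2}$ has transition probabilities $$p_{1/2}((m,s),(m+1,s+1))=\tfrac12\cdot\tfrac{s+2}{s+1},\qquad p_{1/2}((m,s),(m+1,s-1))=1-\tfrac12\cdot\tfrac{s+2}{s+1}.$$ *)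

(* Defs.v *)
From HB Require Import structures.
From mathcomp Require Import all_boot all_order all_algebra.
From mathcomp Require Import lra ring.
From mathcomp Require Import all_classical all_reals all_analysis measurable_realfun.
Import Order.TTheory GRing.Theory Num.Theory.
Import numFieldNormedType.Exports.

Set Implicit Arguments.
Unset Strict Implicit.
Unset Printing Implicit Defensive.

Local Open Scope classical_set_scope.
Local Open Scope ring_scope.

(* A lattice path with steps (1,1) and (1,-1) started at (0,0) visits the
   points (n, x n), so it is given by its heights x; the heights being natural
   numbers says that the path stays in N x N. *)
Definition ballot_step : rel nat :=
  fun s t => (t == s.+1) || (s == t.+1).

Record ballot_path := BallotPath {
  height :> nat -> nat ;
  height0 : height 0%N = 0%N ;
  height_step : forall n, ballot_step (height n) (height n.+1) }.

Program Definition zigzag := @BallotPath (fun n => odd n : nat) _ _.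
Next Obligation. by []. Qed.
Next Obligation. by move=> n /=; case: (odd n). Qed.

HB.instance Definition _ := gen_eqMixin ballot_path.
HB.instance Definition _ := gen_choiceMixin ballot_path.
HB.instance Definition _ := isPointed.Build ballot_path zigzag.

(* A finite path from (0,0) of length n is given by the sequence of its
   heights at the times 1, ..., n. *)
Definition initial_segment (n : nat) (x : ballot_path) : seq nat :=
  [seq x i | i <- iota 1 n].

Definition cylinder (w : seq nat) : set ballot_path :=
  [set x | initial_segment (size w) x = w].

Definition ballot_space := g_sigma_algebraType (range cylinder).

Definition passes_through (n k : nat) : set ballot_path :=
  [set x | x n = k].

(* The heights of a ballot path of length n are at most n, so that there is no
   loss in taking them in 'I_n.+1. *)
Definition ballot_paths_to (n k : nat) : {set n.-tuple 'I_n.+1} :=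
  [set w : n.-tuple 'I_n.+1 |
    path ballot_step 0%N (map val w) & last 0%N (map val w) == k]%SET.

Section random_ballot_paths.
Context {R : realType}.
Implicit Types P : probability ballot_space R.

(* Only used when B has positive probability. *)
Definition cond_prob P (A B : set ballot_space) : R :=
  fine (P (A `&` B)) / fine (P B).

Definition central P : Prop :=
  forall n k : nat, P (passes_through n k) != 0%E ->
  forall w : n.-tuple 'I_n.+1, w \in ballot_paths_to n k ->
    cond_prob P (cylinder (map val w)) (passes_through n k) =
    #|ballot_paths_to n k|%:R^-1.

Definition up_prob (l : R) (s : nat) : R :=
  if l == 2^-1 then 2^-1 * (s.+2%:R / s.+1%:R)
  else ((1 - l) ^+ s.+2 - l ^+ s.+2) / ((1 - l) ^+ s.+1 - l ^+ s.+1).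

Definition half_one : set (measurableTypeR R) := `[2^-1, 1]%classic.

Definition transition_prob (l : R) (s t : nat) : R :=
  if t == s.+1 then up_prob l s
  else if s == t.+1 then 1 - up_prob l s
  else 0.

(* P is the law of the Markov chain M^l: given the whole past w, which ends at
   the height last 0 w, the next height is t with probability
   transition_prob l (last 0 w) t. *)
Definition is_chain_law (l : R) P : Prop :=
  forall (w : seq nat) (t : nat), P (cylinder w) != 0%E ->
    cond_prob P (cylinder (rcons w t)) (cylinder w) =
    transition_prob l (last 0%N w) t.

(* The law of M^l exists for every l in [1/2,1]: it is the image of the uniform
   law on [0,1] under the map which reads off the steps of the path from u by
   successively splitting the current interval in the ratio p : 1 - p. *)
Section existence.

Section walk.
Variable p : nat -> R.
Hypotheses (p_ge0 : forall s, 0 <= p s) (p_le1 : forall s, p s <= 1).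
Hypothesis (p0 : p 0%N = 1).

Definition walk_step (z : nat * R) : nat * R :=
  if (z.1 == 0%N) || (z.2 < p z.1) then (z.1.+1, z.2 / p z.1)
  else (z.1.-1, (z.2 - p z.1) / (1 - p z.1)).

Definition clamp (u : R) : R := if 0 <= u < 1 then u else 0.

Definition walk_height (u : R) (n : nat) : nat :=
  (iter n walk_step (0%N, clamp u)).1.

Lemma walk_heightP u n : ballot_step (walk_height u n) (walk_height u n.+1).
Proof.
rewrite /walk_height iterS; set z := iter n _ _.
rewrite /walk_step /ballot_step; case: z => s v /=.
by case: s => [|s] //=; case: ifP => _ /=; rewrite eqxx ?orbT.
Qed.

Definition walk (u : R) : ballot_path :=
  @BallotPath (walk_height u) erefl (walk_heightP u).

Definition weight : nat -> seq nat -> R := fix weight s w :=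
  if w is t :: w' then
    (if t == s.+1 then p s else if s == t.+1 then 1 - p s else 0) * weight t w'
  else 1.

Lemma weight_rcons s w t : weight s (rcons w t) =
  weight s w * (if t == (last s w).+1 then p (last s w)
                else if last s w == t.+1 then 1 - p (last s w) else 0).
Proof. by elim: w s => [|t' w ih] s /=; rewrite ?mulr1 ?mul1r// ih mulrA. Qed.

Lemma weight_ge0 s w : 0 <= weight s w.
Proof.
elim: w s => //= t w ih s; apply: mulr_ge0 => //.
by case: ifP => // _; case: ifP => // _; rewrite subr_ge0.
Qed.

Definition follows (z : nat * R) (w : seq nat) : bool :=
  [seq (iter i walk_step z).1 | i <- iota 1 (size w)] == w.

Lemma follows_cons z t w :
  follows z (t :: w) = ((walk_step z).1 == t) && follows (walk_step z) w.
Proof.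
rewrite /follows /= eqseq_cons; congr (_ && (_ == _)).
rewrite (iotaDl 1 1) -map_comp; apply: eq_map => i /=.
by rewrite -iterS iterSr.
Qed.

Lemma followsP s w : exists2 a, 0 <= a /\ a + weight s w <= 1 &
  forall u, 0 <= u < 1 -> follows (s, u) w = (a <= u < a + weight s w).
Proof.
elim: w s => [|t w ih] s.
  exists 0; first by rewrite /= add0r.
  by move=> u u01; rewrite /follows /= eqxx add0r u01.
have [a [a0 a1] aP] := ih t.
have wt0 := weight_ge0 t w.
have [ts|ts] := eqVneq t s.+1.
  subst t; exists (p s * a).
    split; first exact: mulr_ge0.
    rewrite /= eqxx -mulrDr; apply: le_trans (p_le1 s).
    exact: ler_piMr.
  move=> u /andP[u0 u1]; rewrite follows_cons /= eqxx /walk_step /=.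
  have [s0|s0] := eqVneq s 0%N.
    subst s; rewrite p0 divr1 !mul1r; by rewrite /= aP ?u0.
  case: ltP => /= ups.
    have ps0 : 0 < p s by exact: le_lt_trans ups.
    rewrite eqxx aP; last by rewrite divr_ge0// ltr_pdivrMr// mul1r.
    by rewrite ler_pdivlMr// ltr_pdivrMr// -mulrDr ![_ * p s]mulrC.
  rewrite -mulrDr (_ : (s.-1 == s.+1) = false) /=; last first.
    by apply/negbTE; rewrite neq_ltn ltnS leq_pred.
  apply/esym/negbTE; rewrite negb_and -!ltNge -leNgt; apply/orP; right.
  by apply: le_trans ups; exact: ler_piMr.
have [st|st] := eqVneq s t.+1.
  subst s; exists (p t.+1 + (1 - p t.+1) * a).
    have := p_ge0 t.+1; have := p_le1 t.+1 => h1 h0.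
    have q0 : 0 <= 1 - p t.+1 by rewrite subr_ge0.
    split; first by rewrite addr_ge0// mulr_ge0.
    rewrite /= (negbTE ts) eqxx -addrA -mulrDr.
    have := ler_piMr q0 a1; lra.
  move=> u /andP[u0 u1]; rewrite follows_cons /= (negbTE ts) eqxx.
  rewrite /walk_step /= -addrA -mulrDr; case: ltP => /= ups.
    rewrite gtn_eqF//=; apply/esym/negbTE.
    rewrite negb_and -ltNge; apply/orP; left.
    by rewrite (lt_le_trans ups)// lerDl mulr_ge0// subr_ge0.
  have q0 : 0 < 1 - p t.+1 by rewrite subr_gt0 (le_lt_trans ups).
  rewrite eqxx aP; last first.
    rewrite divr_ge0 ?subr_ge0//= ltr_pdivrMr// mul1r; lra.
  rewrite ler_pdivlMr// ltr_pdivrMr// lerBrDl ltrBlDl.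
  by rewrite ![_ * (1 - p t.+1)]mulrC.
exists 0; first by rewrite /= (negbTE ts) (negbTE st) mul0r addr0.
move=> u _; rewrite follows_cons /= (negbTE ts) (negbTE st) mul0r addr0.
rewrite [RHS](_ : _ = false); last by rewrite leNgt andNb.
rewrite (_ : ((walk_step (s, u)).1 == t) = false) //.
apply/negbTE/eqP => tE; move: ts st; rewrite -{}tE /walk_step /=.
case: ifP => /= [_|]; first by rewrite eqxx.
by case: s {ih} => //= s _ _; rewrite eqxx.
Qed.

Lemma cylinder_walk w u : cylinder w (walk u) <-> follows (0%N, clamp u) w.
Proof. by split => [<-|/eqP]//; rewrite /follows /initial_segment size_map size_iota. Qed.

Lemma measurable_walk :
  measurable_fun (setT : set (measurableTypeR R)) (walk : _ -> ballot_space).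
Proof.
apply: (@measurability _ _ _ ballot_space _ _ (range cylinder)) => //.
move=> _ [_ [w _ <-] <-]; rewrite setTI.
have [a _ aP] := followsP 0%N w.
rewrite (_ : _ @^-1` _ = (`[0, 1[ `&` `[a, a + weight 0%N w[) `|`
   (if follows (0%N, 0) w then ~` `[0, 1[ else set0)); last first.
  apply/seteqP; split => [u /cylinder_walk|u].
    rewrite /clamp; case: ifP => u01 uw.
      by left; split; rewrite /= in_itv/= -?aP.
    by right; rewrite uw /= in_itv /= u01.
  move=> ux; apply/cylinder_walk; move: ux; rewrite /clamp.
  case=> [[]|]; first by rewrite /= !in_itv /= => u01; rewrite u01 -aP.
  by case: ifP => //= w0; rewrite in_itv/= => /negP/negbTE ->.
apply: measurableU; first by apply: measurableI; exact: measurable_itv.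
by case: ifP => // _; apply: measurableC; exact: measurable_itv.
Qed.

Lemma uniform_itv (c d : R) : 0 <= c -> c <= d -> d <= 1 ->
  uniform_prob (@ltr01 R) `[c, d[%classic = (d - c)%:E.
Proof.
move=> c0 cd d1; rewrite /uniform_prob.
rewrite (eq_integral (fun=> 1%:E)); last first.
  move=> x; rewrite inE/= in_itv/= /uniform_pdf => /andP[cx xd].
  by rewrite (le_trans c0 cx) (ltW (lt_le_trans xd d1)) subr0 invr1.
rewrite integral_cst//= mul1e lebesgue_measure_itv/= lte_fin.
by case: ltP => // dc; rewrite (@le_anti _ _ c d) ?cd ?dc// subrr.
Qed.

Lemma exists_walk_law : exists P : probability ballot_space R,
  forall w, P (cylinder w) = (weight 0%N w)%:E.
Proof.
pose X : {mfun measurableTypeR R >-> ballot_space} := mfun_Sub (mem_set measurable_walk).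
pose U : probability (measurableTypeR R) R := uniform_prob (@ltr01 R).
exists (distribution U X : probability _ _) => w.
have [a [a0 a1] aP] := followsP 0%N w.
have wt0 := weight_ge0 0%N w.
have mI : measurable (`[0, 1[%classic : set (measurableTypeR R)).
  exact: measurable_itv.
have mX : measurable (X @^-1` (cylinder w)).
  by rewrite -[_ @^-1` _]setTI; apply: measurable_walk => //; apply: sub_sigma_algebra; exists w.
have UI : U `[0, 1[%classic = 1%E by rewrite /U /= uniform_itv// subr0.
have UC : U (~` `[0, 1[) = 0%E by rewrite probability_setC// UI subee.
apply: etrans (measureDI U mX mI) _.
transitivity (0 + U `[a, (a + weight 0%N w)%R[%classic)%E; last first.
  by rewrite add0e /U /= uniform_itv// ?lerDl// addrAC subrr add0r.
congr (_ + U _)%E.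
  apply: (@subset_measure0 _ _ _ U _ (~` `[0, 1[)) => //.
    exact: measurableD.
  exact: measurableC.
apply/seteqP; split => u.
  case=> /cylinder_walk + /=; rewrite !in_itv /= => + u01.
  by rewrite /clamp u01 aP.
rewrite /= in_itv /= => aub.
have u01 : 0 <= u < 1.
  case/andP: aub => au ub.
  by rewrite (le_trans a0 au) (lt_le_trans ub a1).
split; last by rewrite /= in_itv.
by apply/cylinder_walk; rewrite /clamp u01 aP.
Qed.

End walk.

Lemma up_prob0 (l : R) : up_prob l 0 = 1.
Proof.
rewrite /up_prob; case: eqVneq => [_|lN]; first by field.
have d : 1 - l - l != 0 by apply: contraNneq lN => h; apply/eqP; lra.
by rewrite !expr1; field.
Qed.

Lemma up_prob_bounds (l : R) s : 2^-1 <= l <= 1 -> 0 <= up_prob l s <= 1.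
Proof.
move=> /andP[l2 l1]; rewrite /up_prob; case: eqVneq => [_|lN].
  rewrite mulrA ler_pdivlMr ?ltr0n// ler_pdivrMr ?ltr0n// mul0r mul1r.
  have s0 : 0 <= s%:R :> R by [].
  rewrite -[s.+2%:R]natr1 -[s.+1%:R]natr1.
  by apply/andP; split; lra.
have lgt : 1 - l < l.
  have : 2^-1 < l by rewrite lt_neqAle eq_sym lN.
  lra.
have l0 : 0 <= 1 - l by lra.
have D_ge0 n : 0 <= l ^+ n - (1 - l) ^+ n.
  by rewrite subr_ge0 lerXn2r// ?nnegrE; lra.
have D_gt0 : 0 < l ^+ s.+1 - (1 - l) ^+ s.+1.
  by rewrite subr_gt0 ltrXn2r// ?nnegrE; lra.
rewrite -opprB -[X in _ / X]opprB invrN mulrNN.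
rewrite ler_pdivlMr// ler_pdivrMr// mul0r mul1r D_ge0 /=.
have := D_ge0 s; have -> : l ^+ s.+2 - (1 - l) ^+ s.+2 =
  l ^+ s.+1 - (1 - l) ^+ s.+1 - l * (1 - l) * (l ^+ s - (1 - l) ^+ s).
  by rewrite !exprS; ring.
by move=> Ds; rewrite lerBlDr lerDl !mulr_ge0//; lra.
Qed.

Lemma exists_chain_law (l : R) : 2^-1 <= l <= 1 ->
  exists P : probability ballot_space R, is_chain_law l P.
Proof.
move=> l01.
have h0 s : 0 <= up_prob l s by case/andP: (up_prob_bounds s l01).
have h1 s : up_prob l s <= 1 by case/andP: (up_prob_bounds s l01).
have [P PE] := exists_walk_law h0 h1 (up_prob0 l); exists P => w t.
rewrite /cond_prob (_ : cylinder (rcons w t) `&` cylinder w = cylinder (rcons w t)).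
  rewrite !PE /= weight_rcons /transition_prob => w0.
  by rewrite mulrAC divff ?mul1r//; apply: contra_neq w0 => ->.
apply/setIidPl => x; rewrite /cylinder /= size_rcons /initial_segment.
by rewrite -[(size w).+1]addn1 iotaD map_cat /= cats1 => /rcons_inj [].
Qed.
End existence.

End random_ballot_paths.

(* Main.v *)
Require Import Defs.
From mathcomp Require Import all_boot all_order all_algebra.
From mathcomp Require Import all_classical all_reals all_analysis measurable_realfun.
From mathcomp Require Import ring lra zify.
Import Order.TTheory GRing.Theory Num.Theory.
Import numFieldNormedType.Exports.
Local Open Scope classical_set_scope.
Local Open Scope ring_scope.

(** Centrality says that the mass of a cylinder [w] is a function [phi n k] of
the end point of [w] only, and additivity of the measure says
[phi n k = phi n.+1 k.+1 + phi n.+1 k.-1] (the last term being absent for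
[k = 0]). This recursion determines [phi] from its values [phi (2j) 0]. For the
chain with parameter [l] the mass is [t ^ j * D_k t] with [t = l (1 - l)], where
[D_(k+2) = D_(k+1) - t D_k] are Chebyshev-like polynomials ([chain_poly]), so
its value at [(2j, 0)] is [t ^ j]. Hence the theorem amounts to finding a random
parameter [L] in [1/2, 1] such that [phi (2j) 0] is the [j]-th moment of
[T = L (1 - L)]; the mixing measure is then the law of [L].

Such an [L] lives on the path space itself, as the limit of the slopes
[(1 + X_n / n) / 2] along a subsequence. Let [tau_n k] be the fraction of the
ballot paths to [(n, k)] that begin with an up step and a down step
([return_ratio]). By the closed form of ballot numbers,
[tau_n k = ((n+1)^2 - (k+1)^2) / (4 n (n-1))], so convergence of [tau_n (X_n)] is
convergence of the slopes. By centrality [tau_n (X_n)] is the conditional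
probability of these first two steps given the path from time [n] on; this is a
reverse martingale, so that [E (tau_n - tau_m)^2 = E tau_n^2 - E tau_m^2]
([Rintegral_ratio_diff]) and it is Cauchy in L2. A fast subsequence converges
almost surely ([ae_cvgn_fast_L2]). The fraction of the ballot paths to [(n, k)]
that begin with [j] up-down pairs is a product of [j] factors [tau_(n-2a) k],
which tends to [T ^ j]; its mean is [phi (2j) 0], and dominated convergence gives
the moments ([exists_limit_parameter]).

Equality of the two laws then holds on cylinders, and a Dynkin class argument
extends it to all measurable sets ([mixing_of_cylinders]). *)

(** * Ballot numbers *)

Section ballot_numbers.
Context {R : realType}.
Implicit Types (F : nat -> R) (n k m : nat).

(** This operator takes a function of the height at time [n + 1] back to time [n].
Its matrix is symmetric, which is why iterating it on the indicator of the origin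
also counts the paths forwards. *)
Definition succ_sum F k : R := F k.+1 + (if k is k'.+1 then F k' else 0).

Definition ballot_number n : nat -> R :=
  iter n succ_sum (fun k => (k == 0%N)%:R).

Lemma ballot_numberS n k :
  ballot_number n.+1 k = succ_sum (ballot_number n) k.
Proof. by []. Qed.

Lemma ballot_number_gt n k : (n < k)%N -> ballot_number n k = 0.
Proof.
elim: n k => [|n ih] [|k]// nk; rewrite ballot_numberS /succ_sum.
by rewrite !ih ?addr0//; lia.
Qed.

(** Summing over the paths of length [n] from the origin amounts to summing over
their end points, weighted by the number of paths. *)
Lemma iter_succ_sum0 n m F : (n < m)%N ->
  iter n succ_sum F 0%N = \sum_(k < m) ballot_number n k * F k.
Proof.
elim: n m F => [|n ih] [|m] F// nm.
  rewrite big_ord_recl /= mul1r big1 ?addr0// => i _.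
  by rewrite mul0r.
rewrite iterSr (ih m.+1); last exact: ltnW.
under eq_bigr do rewrite /succ_sum mulrDr.
under [RHS]eq_bigr do rewrite ballot_numberS /succ_sum mulrDl.
rewrite !big_split /= addrC; congr (_ + _).
  rewrite big_ord_recl mulr0 add0r [RHS]big_ord_recr /=.
  by rewrite (ballot_number_gt n m.+1) ?mul0r ?addr0// ltnW.
rewrite big_ord_recr [RHS]big_ord_recl /= mul0r add0r.
by rewrite (ballot_number_gt n m) ?mul0r ?addr0.
Qed.

(** The quotient of two entries of a row, read off from the closed form
[n! (k+1) / (((n-k)/2)! ((n+k)/2+1)!)]. Stated without division or parity
conditions, it can be proved directly from the recursion. *)
Lemma ballot_number_row n k :
  (k%:R + 1) * (n%:R + k%:R + 4) * ballot_number n k.+2 =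
  (k%:R + 3) * (n%:R - k%:R) * ballot_number n k.
Proof.
elim: n k => [|n ih] k.
  rewrite ballot_number_gt// mulr0; case: k => [|k]; first by rewrite subrr mulr0 mul0r.
  by rewrite ballot_number_gt// mulr0.
rewrite !ballot_numberS /succ_sum.
have k2 : k%:R + 2 != 0 :> R by rewrite -(natrD _ k 2) pnatr_eq0 addn2.
apply: (mulfI k2).
have := ih k.+1; case: k {k2} => [|k].
  rewrite -[n.+1%:R]natr1; lra.
have := ih k; rewrite -[n.+1%:R]natr1 -[k.+2%:R]natr1 -[k.+1%:R]natr1.
move=> /(congr1 (fun u => (k%:R + 4) * u)) h1.
move=> /(congr1 (fun u => (k%:R + 2) * u)) h2; lra.
Qed.

Lemma ballot_number_col n k :
  (n.+2%:R - k%:R) * (n%:R + k%:R + 4) * ballot_number n.+2 k =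
  4 * (n%:R + 1) * (n%:R + 2) * ballot_number n k.
Proof.
have E : ballot_number n.+2 k = ballot_number n k.+2 +
   (if k is 0 then 1 else 2) * ballot_number n k
   + (if k is k'.+2 then ballot_number n k' else 0).
  rewrite ballot_numberS /succ_sum; case: k => [|[|k]];
    rewrite !ballot_numberS /succ_sum; lra.
have k1 : k%:R + 1 != 0 :> R by rewrite natr1 pnatr_eq0.
apply: (mulfI k1); rewrite E -[n.+2%:R]natr1 -[n.+1%:R]natr1.
have := ballot_number_row n k.
move=> /(congr1 (fun u => (n%:R + 2 - k%:R) * u)) h1.
case: k {E} h1 k1 => [|[|k]]; [lra | lra |].
have := ballot_number_row n k; rewrite -[k.+2%:R]natr1 -[k.+1%:R]natr1.
move=> /(congr1 (fun u => (n%:R + k%:R + 6) * u)) h2 h1 _; lra.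
Qed.

(** For a reachable point [(n, k)] this is the quotient
[ballot_number (n-2) k / ballot_number n k]: the probability that a uniform ballot
path to [(n, k)] starts with the steps up, down. *)
Definition return_ratio n k : R :=
  (n.+1%:R ^+ 2 - k.+1%:R ^+ 2) / (4 * n%:R * (n%:R - 1)).

(** Weighting the end point by [return_ratio] has the same effect on a path sum
as forcing the first two steps to be up, down. *)
Lemma iter_return_ratio n F :
  iter n.+2 succ_sum (fun k => return_ratio n.+2 k * F k) 0%N = iter n succ_sum F 0%N.
Proof.
rewrite (iter_succ_sum0 n.+2 n.+3)// (iter_succ_sum0 n n.+3); last lia.
apply: eq_bigr => k _.
rewrite mulrA; congr (_ * _); rewrite /return_ratio.
have := ballot_number_col n k.
have n1 : n%:R + 1 != 0 :> R by rewrite natr1 pnatr_eq0.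
have n2 : n%:R + 2 != 0 :> R by rewrite -(natrD _ n 2) pnatr_eq0 addn2.
rewrite -[n.+3%:R]natr1 -[n.+2%:R]natr1 -[n.+1%:R]natr1 -[k.+1%:R]natr1 => h.
apply: (@mulfI _ (4 * (n%:R + 1) * (n%:R + 2))).
  by rewrite !mulf_neq0.
rewrite -h; field.
by rewrite addrK n1 -addrA -(natrD _ 1 1) n2.
Qed.
End ballot_numbers.

(** * The path space *)

Section path_space.
Set Implicit Arguments.
Unset Strict Implicit.
Implicit Types (x : ballot_path) (w : seq nat) (n k : nat).

Lemma initial_segmentS n x :
  initial_segment n.+1 x = rcons (initial_segment n x) (x n.+1).
Proof. by rewrite /initial_segment -[n.+1]addn1 iotaD map_cat /= cats1 addn1. Qed.

Lemma size_initial_segment n x : size (initial_segment n x) = n.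
Proof. by rewrite size_map size_iota. Qed.

Lemma last_initial_segment n x : last 0%N (initial_segment n x) = x n.
Proof.
by case: n => [|n]; rewrite ?height0// initial_segmentS last_rcons.
Qed.

Lemma last_cylinder w x : cylinder w x -> last 0%N w = x (size w).
Proof. by move=> <-; rewrite last_initial_segment size_initial_segment. Qed.

Lemma cylinder_rcons w k x :
  cylinder (rcons w k) x <-> cylinder w x /\ x (size w).+1 = k.
Proof.
rewrite /cylinder/= size_rcons initial_segmentS; split; last by case=> -> ->.
by move/rcons_inj => [-> ->].
Qed.

Lemma path_initial_segment n x : path ballot_step 0%N (initial_segment n x).
Proof.
elim: n => [//|n ih]; rewrite initial_segmentS rcons_path ih.
by rewrite last_initial_segment height_step.
Qed.

Lemma cylinder_path w : ~~ path ballot_step 0%N w -> cylinder w = set0.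
Proof.
move=> /negP wP; rewrite -subset0 => x xw; apply: wP.
by rewrite -xw path_initial_segment.
Qed.

Lemma take_initial_segment m n x : (m <= n)%N ->
  take m (initial_segment n x) = initial_segment m x.
Proof. by move=> mn; rewrite /initial_segment -map_take take_iota (minn_idPl mn). Qed.

Lemma cylinder_nested v w x : (size v <= size w)%N ->
  cylinder v x -> cylinder w x -> cylinder w `<=` cylinder v.
Proof.
move=> vw xv xw y yw; rewrite /cylinder/= -(take_initial_segment _ vw) yw.
by rewrite -xw take_initial_segment.
Qed.

Lemma setI_closed_cylinder : setI_closed (range cylinder).
Proof.
move=> _ _ [v _ <-] [w _ <-].
have [-> | /set0P[x [xv xw]]] := eqVneq (cylinder v `&` cylinder w) set0.
  by exists [:: 1; 1]%N => //; apply: cylinder_path.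
have [vw|/ltnW wv] := leqP (size v) (size w).
  by exists w => //; apply/esym/setIidPr; exact: cylinder_nested xv xw.
by exists v => //; apply/esym/setIidPl; exact: cylinder_nested xw xv.
Qed.

Lemma height_le x n : (x n <= n)%N.
Proof.
elim: n => [|n ih]; first by rewrite height0.
by have := height_step x n; rewrite /ballot_step => /orP[] /eqP; lia.
Qed.

Lemma parity_path w : path ballot_step 0%N w ->
  exists j, size w = (j.*2 + last 0%N w)%N.
Proof.
elim/last_ind: w => [|w k ih]; first by exists 0%N.
rewrite rcons_path => /andP[/ih[j jw]]; rewrite size_rcons last_rcons jw.
rewrite /ballot_step => /orP[] /eqP ->.
  by exists j; rewrite addnS.
by exists j.+1; rewrite doubleS; lia.
Qed.

Lemma path_le_size w : path ballot_step 0%N w -> all (geq (size w)) w.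
Proof.
elim/last_ind: w => // w k ih pw; have [j] := parity_path pw.
rewrite last_rcons all_rcons => jw.
apply/andP; split; first by rewrite /= jw leq_addl.
move: pw; rewrite rcons_path => /andP[/ih + _].
by apply: sub_all => i /= iw; rewrite size_rcons ltnW.
Qed.

(** A reference path to the point [(2j + k, k)], which is the general form of a
reachable lattice point: [j] up-down pairs, then [k] steps up. *)
Definition standard_path j k : seq nat :=
  initial_segment j.*2 zigzag ++ iota 1 k.

Lemma size_standard_path j k : size (standard_path j k) = (j.*2 + k)%N.
Proof. by rewrite size_cat size_initial_segment size_iota. Qed.

Lemma standard_pathS j k : standard_path j k.+1 = rcons (standard_path j k) k.+1.
Proof. by rewrite /standard_path -[k.+1]addn1 iotaD catA addnC cats1. Qed.

Lemma last_standard_path j k : last 0%N (standard_path j k) = k.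
Proof.
case: k => [|k]; last by rewrite standard_pathS last_rcons.
by rewrite /standard_path cats0 last_initial_segment/= odd_double.
Qed.

Lemma path_standard_path j k : path ballot_step 0%N (standard_path j k).
Proof.
elim: k => [|k ih].
  by rewrite /standard_path cats0 path_initial_segment.
by rewrite standard_pathS rcons_path ih last_standard_path /ballot_step eqxx.
Qed.

Lemma cylinder_split w : path ballot_step 0%N w ->
  cylinder w = cylinder (rcons w (last 0%N w).+1) `|`
    (if last 0%N w is k.+1 then cylinder (rcons w k) else set0).
Proof.
move=> pw; apply/seteqP; split => x.
  move=> xw; have := height_step x (size w); rewrite -(last_cylinder xw).
  case/orP => /eqP E.
    by left; apply/cylinder_rcons; split.
  by right; rewrite E; apply/cylinder_rcons; split.
case; first by case/cylinder_rcons.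
by case: (last _ _) => // k /cylinder_rcons[].
Qed.

Lemma measurable_cylinder w : measurable (cylinder w : set ballot_space).
Proof. by apply: sub_sigma_algebra; exists w. Qed.

Lemma measurable_height {R : realType} n (f : nat -> R) :
  measurable_fun setT (fun x : ballot_space => f ((x : ballot_path) n)).
Proof.
move=> _ B mB; rewrite setTI (_ : _ @^-1` _ =
  \bigcup_w (if (size w == n) && (f (last 0%N w) \in B) then cylinder w else set0)).
  apply: countable_bigcupT_measurable => [|w]; first exact: countableP.
  by case: ifP => // _; exact: measurable_cylinder.
apply/seteqP; split => x.
  move=> /= Bx; exists (initial_segment n x) => //.
  rewrite size_initial_segment eqxx last_initial_segment mem_set//.
  by rewrite /cylinder/= size_initial_segment.
move=> [w _]; case: ifP => // /andP[/eqP wn]; rewrite inE => Bw xw.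
by rewrite /= -wn -(last_cylinder xw).
Qed.
End path_space.

(** * Central measures and integrals over cylinders *)

Section central.
Set Implicit Arguments.
Unset Strict Implicit.
Context {R : realType}.
Variable M : probability ballot_space R.

Lemma central_mass : central M ->
  exists phi : nat -> nat -> R, forall w, path ballot_step 0%N w ->
    fine (M (cylinder w)) = phi (size w) (last 0%N w).
Proof.
move=> cM; exists (fun n k => fine (M (passes_through n k)) / #|ballot_paths_to n k|%:R).
move=> w pw; set n := size w; set k := last 0%N w.
have wk : cylinder w `<=` passes_through n k.
  by move=> x xw; rewrite /passes_through/= -(last_cylinder xw).
have mk : measurable (passes_through n k : set ballot_space).
  have -> : passes_through n k =
      (fun x : ballot_space => (((x : ballot_path) n)%:R : R)) @^-1` [set k%:R].
    by apply/seteqP; split => x /=; [move=> -> | move/eqP; rewrite eqr_nat => /eqP].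
  rewrite -[X in measurable X]setTI; exact: (measurable_height n (fun j => j%:R)).
have [M0|M0] := eqVneq (M (passes_through n k)) 0%E.
  rewrite M0 mul0r (_ : M (cylinder w) = 0%E)//.
  apply: (@subset_measure0 _ _ _ M _ (passes_through n k)) => //.
  exact: measurable_cylinder.
have hw : all (fun i => (i < n.+1)%N) w.
  exact: path_le_size.
pose t := map (insubd (ord0 : 'I_n.+1)) w.
have tw : map val t = w.
  rewrite -map_comp map_id_in// => i iw /=; rewrite insubdK//.
  exact: (allP hw).
have st : size t == n by rewrite size_map.
have tn : Tuple st \in ballot_paths_to n k by rewrite inE /= tw pw eqxx.
have EI : cylinder w `&` passes_through n k = cylinder w by exact/setIidPl.
have := cM n k M0 _ tn; rewrite [map _ _]tw /cond_prob EI => E.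
have M1 : fine (M (passes_through n k)) != 0.
  by rewrite fine_eq0//; exact: fin_num_measure.
by rewrite -[LHS](divfK M1) E mulrC.
Qed.

End central.

Section bounded_measurable.
Set Implicit Arguments.
Unset Strict Implicit.
Context {R : realType} d {T : measurableType d}.
Implicit Types f g : T -> R.

(** An algebra of functions that are integrable for every probability, which makes
all integrability conditions structural. *)
Definition bounded_measurable f :=
  measurable_fun setT f /\ exists C : R, forall x, `|f x| <= C.

Lemma bounded_measurable_cst (c : R) : bounded_measurable (fun=> c).
Proof. by split; [exact: measurable_cst | exists `|c|]. Qed.

Lemma bounded_measurableD f g : bounded_measurable f -> bounded_measurable g ->
  bounded_measurable (fun x => f x + g x).
Proof.
move=> [mf [C fC]] [mg [D gD]]; split; first exact: measurable_funD.
by exists (C + D) => x; rewrite (le_trans (ler_normD _ _))// lerD.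
Qed.

Lemma bounded_measurableM f g : bounded_measurable f -> bounded_measurable g ->
  bounded_measurable (fun x => f x * g x).
Proof.
move=> [mf [C fC]] [mg [D gD]]; split; first exact: measurable_funM.
by exists (C * D) => x; rewrite normrM ler_pM.
Qed.

Lemma bounded_measurableB f g : bounded_measurable f -> bounded_measurable g ->
  bounded_measurable (fun x => f x - g x).
Proof.
move=> bf bg; have := bounded_measurableD bf
  (bounded_measurableM (bounded_measurable_cst (-1)) bg).
by under eq_fun do rewrite mulN1r.
Qed.

Lemma bounded_measurableX f n : bounded_measurable f ->
  bounded_measurable (fun x => f x ^+ n).
Proof.
move=> bf; elim: n => [|n ih]; first exact: bounded_measurable_cst.
by under eq_fun do rewrite exprS; exact: bounded_measurableM.
Qed.

Lemma integrable_bounded_measurable (P : probability T R) (D : set T) f :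
  measurable D -> bounded_measurable f -> P.-integrable D (EFin \o f).
Proof.
move=> mD [mf [C fC]]; apply: (@integrableS _ _ _ P setT) => //.
apply: measurable_bounded_integrable => //.
  by rewrite ltey_eq fin_num_measure.
exists C; split; first by rewrite num_real.
by move=> c Cc x _ /=; rewrite (le_trans (fC x))// ltW.
Qed.
End bounded_measurable.

Section cylinder_integrals.
Set Implicit Arguments.
Unset Strict Implicit.
Context {R : realType}.
Variable M : probability ballot_space R.
Implicit Types (Z : ballot_space -> R) (w : seq nat) (f F : nat -> R).

Lemma bounded_measurable_height n f :
  bounded_measurable (fun x : ballot_space => f ((x : ballot_path) n)).
Proof.
split; first exact: measurable_height.
exists (\sum_(k < n.+1) `|f k|) => x.
have xn : (x n < n.+1)%N by rewrite ltnS height_le.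
by rewrite (bigD1 (Ordinal xn))//= lerDl sumr_ge0.
Qed.

Lemma Rintegral_cylinder_split Z w :
  bounded_measurable Z -> path ballot_step 0%N w ->
  \int[M]_(x in cylinder w) Z x =
  \int[M]_(x in cylinder (rcons w (last 0%N w).+1)) Z x +
  (if last 0%N w is k.+1 then \int[M]_(x in cylinder (rcons w k)) Z x else 0).
Proof.
move=> bZ pw; rewrite {1}(cylinder_split pw) Rintegral_setU.
- by congr (_ + _); case: (last _ _) => //; exact: Rintegral_set0.
- exact: measurable_cylinder.
- by case: (last _ _) => // k; exact: measurable_cylinder.
- apply: integrable_bounded_measurable => //; apply: measurableU.
    exact: measurable_cylinder.
  by case: (last _ _) => // k; exact: measurable_cylinder.
- apply/disj_setPS => x [/cylinder_rcons [_ E1]].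
  case: (last 0%N w) E1 => // k E1 /cylinder_rcons [_ E2].
  by move: E1; rewrite E2; lia.
Qed.

(** Integrals that depend only on the end point of the cylinder propagate to
earlier times, because a cylinder is the disjoint union of its one-step
extensions. This is how centrality enters every expectation below. *)
Lemma Rintegral_cylinder_iter Z F n d :
  bounded_measurable Z ->
  (forall w, path ballot_step 0%N w -> size w = (n + d)%N ->
    \int[M]_(x in cylinder w) Z x = F (last 0%N w)) ->
  forall w, path ballot_step 0%N w -> size w = n ->
    \int[M]_(x in cylinder w) Z x = iter d succ_sum F (last 0%N w).
Proof.
move=> bZ; elim: d n => [|d ih] n ZF w pw wn; first by rewrite ZF// addn0.
rewrite Rintegral_cylinder_split// iterS /succ_sum.
have ih' k : ballot_step (last 0%N w) k ->
    \int[M]_(x in cylinder (rcons w k)) Z x = iter d succ_sum F k.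
  move=> wk; rewrite (ih n.+1) ?last_rcons ?rcons_path ?pw ?wk ?size_rcons ?wn//.
  by move=> v pv vn; apply: ZF; rewrite // addnS.
rewrite ih' /ballot_step ?eqxx//; congr (_ + _).
by case: (last 0%N w) ih' => // k -> //; rewrite /ballot_step eqxx orbT.
Qed.

Lemma Rintegral_cylinder_height Z f w : bounded_measurable Z ->
  \int[M]_(x in cylinder w) (f ((x : ballot_path) (size w)) * Z x) =
  f (last 0%N w) * \int[M]_(x in cylinder w) Z x.
Proof.
move=> bZ; rewrite -RintegralZl//; last 2 first.
- exact: measurable_cylinder.
- by apply: integrable_bounded_measurable => //; exact: measurable_cylinder.
by apply: eq_Rintegral => x; rewrite inE => /last_cylinder ->.
Qed.

Variable phi : nat -> nat -> R.
Hypothesis phiP : forall w, path ballot_step 0%N w ->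
    fine (M (cylinder w)) = phi (size w) (last 0%N w).

Lemma Rintegral_cylinder_future n d f w : path ballot_step 0%N w -> size w = n ->
  \int[M]_(x in cylinder w) f ((x : ballot_path) (n + d)%N) =
  iter d succ_sum (fun k => f k * phi (n + d)%N k) (last 0%N w).
Proof.
apply: Rintegral_cylinder_iter; first exact: bounded_measurable_height.
move=> v pv vn; rewrite -vn -phiP//.
have mv := measurable_cylinder v.
transitivity (f (last 0%N v) * \int[M]_(x in cylinder v) 1); last first.
  by rewrite Rintegral_cst// mul1r.
rewrite -Rintegral_cylinder_height; last exact: bounded_measurable_cst.
by apply: eq_Rintegral => x _; rewrite mulr1.
Qed.

End cylinder_integrals.

(** * Almost sure convergence of rapidly Cauchy sequences *)

Section ae_convergence.
Set Implicit Arguments.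
Unset Strict Implicit.
Context {R : realType} d {T : measurableType d} (P : probability T R).

Lemma sum_half_le n : \sum_(0 <= i < n) 2^-1 ^+ i <= 2 :> R.
Proof.
suff -> : \sum_(0 <= i < n) 2^-1 ^+ i = 2 - 2 * 2^-1 ^+ n :> R.
  by rewrite gerBl mulr_ge0// exprn_ge0.
elim: n => [|n ih]; first by rewrite big_nil expr0 mulr1 subrr.
by rewrite big_nat_recr//= ih exprS; field.
Qed.

Lemma cvgn_fin_num_nneseries (u : nat -> R) :
  (\sum_(i <oo) `|u i.+1 - u i|%:E \is a fin_num)%E -> cvgn u.
Proof.
set S := (\sum_(i <oo) _)%E => Sfin.
have uE : u = (fun n => u 0%N + series (telescope u) n).
  by apply/funext => n; rewrite -eq_sum_telescope.
rewrite uE; apply: is_cvgD; first exact: is_cvg_cst.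
apply: normed_cvg; apply: nondecreasing_is_cvgn.
  by apply: nondecreasing_series => n _ _; exact: normr_ge0.
exists (fine S) => _ [n _ <-].
rewrite -lee_fin fineK// /series/= -sumEFin.
by apply: nneseries_lim_ge => i _; rewrite lee_fin.
Qed.

(** The sum of the absolute increments has finite mean, because
[|d| <= d^2 / (2 a) + a / 2] with [a = 2^-i] turns the bound on the second moment
of the [i]-th increment into the bound [2^-i] on its first absolute moment. *)
Lemma ae_cvgn_fast_L2 (Y : nat -> T -> R) :
  (forall i, bounded_measurable (Y i)) ->
  (forall i, \int[P]_x ((Y i x - Y i.+1 x) ^+ 2) <= 2^-1 ^+ i ^+ 2) ->
  {ae P, forall x, cvgn (Y ^~ x)}.
Proof.
move=> bY YL2.
pose D i x := `|Y i.+1 x - Y i x|.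
have bD2 i : bounded_measurable (fun x => (Y i x - Y i.+1 x) ^+ 2).
  exact/bounded_measurableX/bounded_measurableB.
have bD i : bounded_measurable (D i).
  have [mB [C BC]] := bounded_measurableB (bY i.+1) (bY i); split.
    exact: measurableT_comp.
  by exists C => x; rewrite normr_id.
have D1 i : (\int[P]_x (D i x)%:E <= (2^-1 ^+ i)%:E)%E.
  have iD := integrable_bounded_measurable P measurableT (bD i).
  rewrite -[leLHS]fineK; last exact: integrable_fin_num.
  rewrite lee_fin; set a : R := 2^-1 ^+ i.
  have a0 : 0 < a by rewrite exprn_gt0.
  have bg : bounded_measurable (fun x => (2 * a)^-1 * (Y i x - Y i.+1 x) ^+ 2 + a / 2).
    apply: bounded_measurableD; last exact: bounded_measurable_cst.
    by apply: bounded_measurableM => //; exact: bounded_measurable_cst.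
  apply: (@le_trans _ _ (\int[P]_x ((2 * a)^-1 * (Y i x - Y i.+1 x) ^+ 2 + a / 2))).
    apply: le_Rintegral => //; first exact: integrable_bounded_measurable.
    move=> x _; rewrite /D distrC; set t := _ - _.
    rewrite -subr_ge0 -[t ^+ 2]real_normK ?num_real//.
    (* the inequality between arithmetic and geometric means *)
    have -> : (2 * a)^-1 * `|t| ^+ 2 + a / 2 - `|t| = (2 * a)^-1 * (`|t| - a) ^+ 2.
      by field; rewrite gt_eqF.
    by rewrite mulr_ge0 ?sqr_ge0// invr_ge0 mulr_ge0// ltW.
  rewrite RintegralD//; last 2 first.
  - apply: integrable_bounded_measurable => //.
    by apply: bounded_measurableM => //; exact: bounded_measurable_cst.
  - by apply: integrable_bounded_measurable => //; exact: bounded_measurable_cst.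
  rewrite Rintegral_cst// [X in fine X](_ : _ = 1%E); last exact: probability_setT.
  rewrite RintegralZl//; last first.
    by apply: integrable_bounded_measurable; last exact: bD2.
  rewrite mulr1.
  have : (2 * a)^-1 * \int[P]_x ((Y i x - Y i.+1 x) ^+ 2) <= (2 * a)^-1 * a ^+ 2.
    by rewrite ler_wpM2l ?invr_ge0 ?mulr_ge0 ?(ltW a0)//; exact: YL2.
  have -> : (2 * a)^-1 * a ^+ 2 = a / 2 by field; rewrite gt_eqF.
  lra.
pose S x := (\sum_(i <oo) (D i x)%:E)%E.
have mD i : measurable_fun setT (fun x => (D i x)%:E).
  by apply/measurable_EFinP; case: (bD i).
have S0 x : (0 <= S x)%E by apply: nneseries_ge0 => i _ _; rewrite lee_fin normr_ge0.
have iS : P.-integrable setT S.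
  apply/integrableP; split.
    by apply: ge0_emeasurable_sum => // i x _ _; rewrite lee_fin normr_ge0.
  under eq_integral do rewrite gee0_abs//.
  rewrite /S integral_nneseries//; last by move=> i x _; rewrite lee_fin normr_ge0.
  apply: (@le_lt_trans _ _ 2%:E); last exact: ltry.
  apply: lime_le.
    apply: is_cvg_nneseries => i _ _.
    by apply: integral_ge0 => x _; rewrite lee_fin normr_ge0.
  apply: nearW => n; apply: le_trans; first by apply: lee_sum => i _; exact: D1.
  by rewrite sumEFin lee_fin sum_half_le.
have := integrable_ae measurableT iS; apply: filterS => x /(_ I).
exact: cvgn_fin_num_nneseries.
Qed.

End ae_convergence.

(** * The reverse martingale of return ratios *)

Section moments.
Set Implicit Arguments.
Unset Strict Implicit.
Context {R : realType}.
Variable M : probability ballot_space R.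
Variable phi : nat -> nat -> R.
Hypothesis phiP : forall w, path ballot_step 0%N w ->
    fine (M (cylinder w)) = phi (size w) (last 0%N w).

Definition return_ratio_at n (x : ballot_space) : R :=
  return_ratio n ((x : ballot_path) n).

Lemma cylinder_nil : cylinder [::] = setT.
Proof. by apply/seteqP; split. Qed.

Lemma bounded_measurable_return_ratio_at n : bounded_measurable (return_ratio_at n).
Proof. exact: bounded_measurable_height. Qed.

(** The reverse martingale property, tested against the later value itself: both
sides are the integral of [return_ratio_at m] over the paths that start with up,
down, whatever the earlier time is. *)
Lemma Rintegral_return_ratio_at n m : (n.+2 <= m)%N ->
  \int[M]_x (return_ratio_at n.+2 x * return_ratio_at m x) =
  \int[M]_x (return_ratio_at m x ^+ 2).
Proof.
have E l : (l.+2 <= m)%N -> \int[M]_x (return_ratio_at l.+2 x * return_ratio_at m x) =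
    iter (m - 2) succ_sum (fun k => return_ratio m k * phi m k) 0%N.
  move=> lm; rewrite -cylinder_nil.
  rewrite (@Rintegral_cylinder_iter _ M _ (fun k => return_ratio l.+2 k *
    iter (m - l.+2) succ_sum (fun k => return_ratio m k * phi m k) k) 0 l.+2)//.
  - by rewrite iter_return_ratio -iterD; congr (iter _ _ _ _); lia.
  - by apply: bounded_measurableM; exact: bounded_measurable_return_ratio_at.
  - move=> v pv vl; rewrite add0n in vl.
    have := @Rintegral_cylinder_future _ M _ phiP l.+2 (m - l.+2) (return_ratio m) v pv vl.
    rewrite subnKC// => <-; rewrite -Rintegral_cylinder_height ?vl//.
    exact: bounded_measurable_height.
move=> nm; rewrite E//.
under [RHS]eq_Rintegral do rewrite expr2.
have := E m.-2; have -> : m.-2.+2 = m by lia.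
by move=> ->.
Qed.

Definition ratio_energy n : R := \int[M]_x (return_ratio_at n x ^+ 2).

Lemma Rintegral_ratio_diff n m : (2 <= n <= m)%N ->
  \int[M]_x ((return_ratio_at n x - return_ratio_at m x) ^+ 2) =
  ratio_energy n - ratio_energy m.
Proof.
move=> /andP[n2 nm].
have b l := bounded_measurable_return_ratio_at l.
have bM l l' := bounded_measurableM (b l) (b l').
have int := @integrable_bounded_measurable _ _ _ M setT _ measurableT.
transitivity (\int[M]_x (return_ratio_at n x ^+ 2 -
    (return_ratio_at n x * return_ratio_at m x +
     (return_ratio_at n x * return_ratio_at m x - return_ratio_at m x ^+ 2)))).
  by apply: eq_Rintegral => x _; ring.
rewrite RintegralB//; last 2 first.
- exact/int/bounded_measurableX.
- apply/int/bounded_measurableD => //.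
  by apply: bounded_measurableB => //; exact: bounded_measurableX.
rewrite RintegralD//; last 2 first.
- exact/int.
- by apply/int/bounded_measurableB => //; exact: bounded_measurableX.
rewrite RintegralB//; last 2 first.
- exact/int.
- exact/int/bounded_measurableX.
have -> : n = n.-2.+2 by lia.
rewrite Rintegral_return_ratio_at; last lia.
by rewrite /ratio_energy; ring.
Qed.

(** The second moments decrease, since their differences are integrals of
squares, and so converge. *)
Lemma exists_fast_subsequence : exists s : nat -> nat,
  (forall i, i.+2 <= s i)%N /\ (forall i, (s i <= s i.+1)%N) /\
  forall i, ratio_energy (s i) - ratio_energy (s i.+1) <= 2^-1 ^+ i ^+ 2.
Proof.
pose e n := ratio_energy n.+2.
have e_noninc : nonincreasing_seq e.
  apply/nonincreasing_seqP => n; rewrite -subr_ge0 /e -Rintegral_ratio_diff; last lia.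
  by apply: Rintegral_ge0 => x _; exact: sqr_ge0.
have e_cvg : cvgn e.
  apply: nonincreasing_is_cvgn => //; exists 0 => _ [n _ <-].
  by apply: Rintegral_ge0 => x _; exact: sqr_ge0.
have e_near i : exists N, forall n, (N <= n)%N -> e n - limn e <= 2^-1 ^+ i ^+ 2.
  have a0 : 0 < 2^-1 ^+ i ^+ 2 :> R by rewrite !exprn_gt0.
  have /cvgrPdist_le /(_ _ a0) [N _ NP] := e_cvg.
  exists N => n Nn; have := NP n Nn; rewrite distrC; apply: le_trans.
  exact: ler_norm.
have [N NP] := choice e_near.
exists (fun i => (i + \sum_(j < i.+1) N j).+2).
split; first by move=> i; lia.
split; first by move=> i; rewrite [in leqRHS]big_ord_recr/=; lia.
move=> i; rewrite -/(e _) -/(e (i.+1 + _)%N).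
apply: (@le_trans _ _ (e (i + \sum_(j < i.+1) N j)%N - limn e)).
  by rewrite lerB//; exact: nonincreasing_cvgn_ge.
by apply: NP; rewrite big_ord_recr/=; lia.
Qed.

Lemma ae_cvgn_return_ratio_at : exists s : nat -> nat,
  (forall i, i.+2 <= s i)%N /\
  {ae M, forall x, cvgn (fun i => return_ratio_at (s i) x)}.
Proof.
have [s [s2 [ss se]]] := exists_fast_subsequence.
exists s; split=> //; apply: ae_cvgn_fast_L2 => i.
  exact: bounded_measurable_return_ratio_at.
rewrite Rintegral_ratio_diff ?se// ss andbT.
by have := s2 i; lia.
Qed.

(** For a reachable point [(n, k)], the probability that a uniform ballot path to
[(n, k)] starts with [j] up-down pairs. *)
Fixpoint zigzag_ratio j n k : R :=
  if j is j'.+1 then return_ratio n k * zigzag_ratio j' n.-2 k else 1.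

Lemma iter_zigzag_ratio j n F : (j.*2 <= n)%N ->
  iter n succ_sum (fun k => zigzag_ratio j n k * F k) 0%N =
  iter (n - j.*2) succ_sum F 0%N.
Proof.
elim: j n => [|j ih] n.
  by rewrite subn0 => _; congr (iter _ _ _ _); apply/funext => k; rewrite mul1r.
case: n => [//|[//|n]]; rewrite doubleS !ltnS => jn.
rewrite !subSS -ih//.
rewrite -[RHS]iter_return_ratio; congr (iter _ _ _ _); apply/funext => k.
by rewrite mulrA.
Qed.

(** By centrality the mean of the conditional probability of the initial zigzag
given [X_n] is the probability of that zigzag. *)
Lemma Rintegral_zigzag_ratio j n : (j.*2 <= n)%N ->
  \int[M]_x zigzag_ratio j n ((x : ballot_path) n) =
  fine (M (cylinder (standard_path j 0))).
Proof.
move=> jn.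
rewrite -cylinder_nil (@Rintegral_cylinder_future _ M _ phiP 0 n)//=.
rewrite iter_zigzag_ratio//.
have := @Rintegral_cylinder_future _ M _ phiP (j.*2) (n - j.*2) (fun=> 1) _
  (path_standard_path j 0).
rewrite size_standard_path addn0 last_standard_path subnKC// => /(_ erefl).
rewrite Rintegral_cst ?mul1r; last exact: measurable_cylinder.
move=> ->; congr (iter _ _ _ _); apply/funext => k.
by rewrite mul1r.
Qed.

End moments.

(** * The limiting slope *)

Section slope.
Set Implicit Arguments.
Unset Strict Implicit.
Context {R : realType}.

(** The shift by one makes the numerator of [return_ratio] a difference of squares
in terms of the slope, and keeps the slope in [0, 1] for [k <= n]. *)
Definition slope n k : R := k.+1%:R / n.+1%:R.

Lemma slope_ge0 n k : 0 <= slope n k.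
Proof. by rewrite divr_ge0. Qed.

Lemma slope_le1 n k : (k <= n)%N -> slope n k <= 1.
Proof. by move=> kn; rewrite ler_pdivrMr ?ltr0n// mul1r ler_nat. Qed.

Lemma return_ratio_slope a n k : (a.*2.+2 <= n)%N ->
  return_ratio (n - a.*2) k =
  ((1 - a.*2%:R * n.+1%:R^-1) ^+ 2 - slope n k ^+ 2) /
  (4 * (1 - (a.*2%:R + 1) * n.+1%:R^-1) * (1 - (a.*2%:R + 2) * n.+1%:R^-1)).
Proof.
move=> an; set m := (n - a.*2)%N.
have -> : n = (m + a.*2)%N by lia.
have m2 : (2 <= m)%N by lia.
rewrite /return_ratio /slope; set A : R := a.*2%:R.
rewrite -[(m + _).+1%:R]natr1 natrD -/A -[m.+1%:R]natr1.
have mR : (2 : R) <= m%:R by rewrite ler_nat.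
have A0 : 0 <= A by rewrite ler0n.
field; apply/and3P; split; apply/eqP; lra.
Qed.

Variable s : nat -> nat.
Hypothesis s_ge : forall i, (i.+2 <= s i)%N.

Lemma cvg_inv_subsequence : (s i).+1%:R^-1 @[i --> \oo] --> (0 : R).
Proof.
apply: (@squeeze_cvgr _ _ _ _ (cst 0) (@harmonic R)); last 2 first.
- exact: cvg_cst.
- exact: cvg_harmonic.
apply: nearW => i; rewrite /= invr_ge0 ler0n /= lef_pV2 ?posrE ?ltr0n// ler_nat.
by have := s_ge i; lia.
Qed.

Variable K : nat -> nat.

Let u i : R := (s i).+1%:R^-1.
Let v i : R := slope (s i) (K i).

(** The square of the slope is an affine function of the return ratio with
convergent coefficients, and slopes are nonnegative. *)
Lemma cvg_slope : cvgn (fun i => return_ratio (s i) (K i) : R) -> cvgn v.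
Proof.
move=> /cvg_ex[/= r rP].
have vE : v = fun i =>
    Num.sqrt (1 - return_ratio (s i) (K i) * (4 * (1 - u i) * (1 - 2 * u i))).
  apply/funext => i; have si := s_ge i.
  have := @return_ratio_slope 0 (s i) (K i); rewrite double0 subn0 => -> //; last lia.
  rewrite mul0r subr0 expr1n add0r mul1r add0r divfK.
    by rewrite subKr sqrtr_sqr ger0_norm// slope_ge0.
  have s0 : (s i).+1%:R != 0 :> R by rewrite pnatr_eq0.
  have s2 : (2 : R) <= (s i)%:R by rewrite ler_nat; lia.
  have -> : 1 - (s i).+1%:R^-1 = (s i)%:R / (s i).+1%:R :> R.
    rewrite -natr1 in s0 *; by field.
  have -> : 1 - 2 * (s i).+1%:R^-1 = ((s i)%:R - 1) / (s i).+1%:R :> R.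
    rewrite -natr1 in s0 *; by field.
  by rewrite !mulf_neq0 ?invr_eq0//; apply/eqP; lra.
apply/cvg_ex; exists (Num.sqrt (1 - r * (4 * (1 - 0) * (1 - 2 * 0)))).
rewrite vE; apply: continuous_cvg; first exact: sqrt_continuous.
apply: cvgB; first exact: cvg_cst.
apply: cvgM; first exact: rP.
have u0 := cvg_inv_subsequence.
apply: cvgM; [apply: cvgM|]; first exact: cvg_cst.
- by apply: cvgB => //; exact: cvg_cst.
- by apply: cvgB; [exact: cvg_cst|apply: cvgM => //; exact: cvg_cst].
Qed.

(** Shifting [n] by a constant while keeping the height does not change the limit;
this is what makes all factors of [zigzag_ratio] have the same limit. *)
Lemma cvg_return_ratio a (V : R) : v @ \oo --> V ->
  (return_ratio (s i - a.*2) (K i) : R) @[i --> \oo] --> (1 - V ^+ 2) / 4.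
Proof.
move=> vV.
have -> : (1 - V ^+ 2) / 4 = ((1 - a.*2%:R * 0) ^+ 2 - V ^+ 2) /
    (4 * (1 - (a.*2%:R + 1) * 0) * (1 - (a.*2%:R + 2) * 0)).
  by rewrite !mulr0 !subr0 expr1n !mulr1.
have u0 := cvg_inv_subsequence.
have linear (c : R) : 1 - c * u i @[i --> \oo] --> 1 - c * 0.
  by apply: cvgB; [exact: cvg_cst|apply: cvgM => //; exact: cvg_cst].
apply: (@cvg_trans _ (((1 - a.*2%:R * u i) ^+ 2 - v i ^+ 2) /
    (4 * (1 - (a.*2%:R + 1) * u i) * (1 - (a.*2%:R + 2) * u i)) @[i --> \oo])).
  apply: near_eq_cvg; exists a.*2 => // i /= ai.
  by rewrite return_ratio_slope//; have := s_ge i; lia.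
apply: cvgM.
  by apply: cvgB; rewrite expr2; under eq_fun do rewrite expr2; exact: cvgM.
apply: cvgV; first by rewrite !mulr0 !subr0 !mulr1.
by apply: cvgM => //; apply: cvgM => //; exact: cvg_cst.
Qed.

Lemma cvg_zigzag_ratio j (V : R) : v @ \oo --> V ->
  (zigzag_ratio j (s i) (K i) : R) @[i --> \oo] --> ((1 - V ^+ 2) / 4) ^+ j.
Proof.
move=> vV; suff H a : (zigzag_ratio j (s i - a.*2) (K i) : R) @[i --> \oo] -->
    ((1 - V ^+ 2) / 4) ^+ j.
  by have := H 0%N; under eq_fun do rewrite double0 subn0.
elim: j a => [|j ih] a; first exact: cvg_cst.
rewrite exprS; apply: cvgM; first exact: cvg_return_ratio.
rewrite (_ : (fun i => _) = fun i => zigzag_ratio j (s i - a.+1.*2) (K i)).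
  exact: ih.
by apply/funext => i /=; congr zigzag_ratio; lia.
Qed.

End slope.

Section bounds.
Context {R : realType}.

(** For [k > m] the ratio is negative, and it is this range of heights that the
hypothesis [n <= 2m] controls: it occurs in the factors of [zigzag_ratio], whose
first argument decreases while the height is only bounded by the original [n]. *)
Lemma return_ratio_le4 n m k : (k <= n)%N -> (n <= m.*2)%N -> (2 <= m)%N ->
  `|return_ratio m k : R| <= 4.
Proof.
move=> kn nm m2; rewrite /return_ratio.
have mR : (2 : R) <= m%:R by rewrite ler_nat.
have kR : k%:R <= 2 * m%:R :> R by rewrite -natrM ler_nat; lia.
have k0 : 0 <= k%:R :> R by rewrite ler0n.
rewrite -[m.+1%:R]natr1 -[k.+1%:R]natr1.
rewrite normrM normfV ler_pdivrMr; last first.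
  by rewrite normr_gt0 !mulf_neq0//; apply/eqP; lra.
rewrite [X in _ * X]ger0_norm; last by rewrite !mulr_ge0//; lra.
by rewrite ler_norml; apply/andP; split; nra.
Qed.

Lemma zigzag_ratio_le j n m k : (k <= n)%N -> (n + j.*2.*2 <= m.*2)%N ->
  (j.*2 + 2 <= m)%N ->
  `|zigzag_ratio j m k : R| <= 4 ^+ j.
Proof.
move=> kn; elim: j m => [|j ih] m nm jm; first by rewrite /= normr1.
rewrite /= normrM exprS ler_pM//; first by apply: (@return_ratio_le4 n); lia.
by apply: ih; lia.
Qed.

End bounds.

Section limit_parameter.
Set Implicit Arguments.
Unset Strict Implicit.
Context {R : realType}.

Lemma limn_sup_itv (u : nat -> R) (a b : R) :
  (forall i, a <= u i <= b) -> a <= limn_sup u <= b.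
Proof.
move=> uab; have bu : bounded_fun u.
  exists (`|a| + `|b|); split; first by rewrite num_real.
  move=> c /ltW abc i _ /=; apply: le_trans abc.
  have /andP[au ub] := uab i.
  rewrite ler_norml; apply/andP; split.
    have := ler_norm (- a); rewrite normrN; have := normr_ge0 b; lra.
  by have := ler_norm b; have := normr_ge0 a; lra.
have hub : has_ubound (range u).
  by exists b => _ [i _ <-]; case/andP: (uab i).
rewrite limn_supE//; apply/andP; split.
  apply: lb_le_inf; first by exists (sups u 0); exists 0%N.
  move=> _ [n _ <-]; case/andP: (uab n) => au _; apply: (le_trans au).
  by apply: ub_le_sup; [exact: has_ubound_sdrop | exists n => /=].
apply: (@le_trans _ _ (sups u 0)); last first.
  apply: ge_sup; first by exists (u 0%N); exists 0%N.
  by move=> _ [i _ <-]; case/andP: (uab i).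
apply: ge_inf; last by exists 0%N.
exists a => _ [n _ <-]; case/andP: (uab n) => au _; apply: (le_trans au).
by apply: ub_le_sup; [exact: has_ubound_sdrop | exists n => /=].
Qed.

Variable M : probability ballot_space R.
Hypothesis M_central : central M.

(** The upper limit of the slopes serves as a version of the limit that is
measurable and bounded everywhere; it is the true limit almost surely. With
[V] the limiting slope and [L = (1 + V) / 2], one has [L (1 - L) = (1 - V^2) / 4],
the limit of the return ratios. *)
Lemma exists_limit_parameter : exists L : ballot_space -> R,
  [/\ measurable_fun setT L, forall x, 2^-1 <= L x <= 1 &
    forall j, \int[M]_x ((L x * (1 - L x)) ^+ j) =
      fine (M (cylinder (standard_path j 0)))].
Proof.
have [phi phiP] := central_mass M_central.
have [s [s_ge s_cvg]] := ae_cvgn_return_ratio_at phiP.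
pose v (x : ballot_space) i : R := slope (s i) ((x : ballot_path) (s i)).
have v01 x i : 0 <= v x i <= 1 by rewrite slope_ge0 slope_le1// height_le.
pose V x : R := limn_sup (v x).
have V01 x : 0 <= V x <= 1 by exact: limn_sup_itv.
have mV : measurable_fun setT V.
  apply: measurable_fun_limn_sup.
  - by move=> x _; exists 1 => _ [i _ <-]; case/andP: (v01 x i).
  - by move=> x _; exists 0 => _ [i _ <-]; case/andP: (v01 x i).
  - by move=> i; exact: (measurable_height (s i) (slope (s i))).
pose L x : R := (1 + V x) / 2.
have mL : measurable_fun setT L.
  apply: measurable_funM; last exact: measurable_cst.
  by apply: measurable_funD => //; exact: measurable_cst.
have L1 x : 2^-1 <= L x <= 1.
  by have /andP[V0 V1] := V01 x; rewrite /L; apply/andP; split; lra.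
exists L; split => // j.
(* the index is shifted so that the bound [4 ^ j] of the ratios is available *)
pose f i (x : ballot_space) : R := let n := s (i + j.*2.*2.+2)%N in
   zigzag_ratio j n ((x : ballot_path) n).
have fE i : (\int[M]_x (f i x)%:E)%E = M (cylinder (standard_path j 0)).
  have n_ge : (j.*2 <= s (i + j.*2.*2.+2))%N by have := s_ge (i + j.*2.*2.+2)%N; lia.
  rewrite -[RHS]fineK; last by rewrite fin_num_measure//; exact: measurable_cylinder.
  rewrite -(Rintegral_zigzag_ratio phiP n_ge) fineK//.
  apply: integrable_fin_num => //; apply: integrable_bounded_measurable => //.
  exact: bounded_measurable_height.
have bLX : bounded_measurable (fun x => (L x * (1 - L x)) ^+ j).
  have bL : bounded_measurable L.
    by split=> //; exists 1 => x; have /andP[? ?] := L1 x; rewrite ger0_norm//; lra.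
  apply: bounded_measurableX; apply: bounded_measurableM => //.
  by apply: bounded_measurableB => //; exact: bounded_measurable_cst.
have mf i : measurable_fun setT (fun x => (f i x)%:E).
  by apply/measurable_EFinP; exact: measurable_height.
have [] := @dominated_convergence _ _ _ M setT measurableT (fun i x => (f i x)%:E)
  (fun x => ((L x * (1 - L x)) ^+ j)%:E) (fun=> (4 ^+ j)%:E) mf.
- by apply/measurable_EFinP; case: bLX.
- apply: filterS s_cvg => x xcvg _; apply: cvg_EFin; first exact: nearW.
  have vV : v x @ \oo --> V x.
    have vx : cvgn (v x) :=
      @cvg_slope _ s s_ge (fun i => (x : ballot_path) (s i)) xcvg.
    by rewrite /V (cvg_limn_supE vx).
  have := @cvg_zigzag_ratio _ s s_ge (fun i => (x : ballot_path) (s i)) j _ vV.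
  rewrite -(cvg_shiftn (j.*2.*2.+2)).
  rewrite (_ : L x * (1 - L x) = (1 - V x ^+ 2) / 4); last by rewrite /L; field.
  done.
- apply: (@integrable_bounded_measurable _ _ _ M setT (fun=> 4 ^+ j)) => //.
  exact: bounded_measurable_cst.
- apply: aeW => x i _; rewrite lee_fin /f.
  apply: zigzag_ratio_le; first exact: height_le; have := s_ge (i + j.*2.*2.+2)%N; lia.
move=> _ _ ; rewrite (_ : [sequence _]_n = fun=> M (cylinder (standard_path j 0))).
  by move=> /(cvg_lim (@ereal_hausdorff R)); rewrite lim_cst// /Rintegral => <-.
by apply/funext => i /=; exact: fE.
Qed.

End limit_parameter.

(** * Masses of cylinders *)

Section chain_masses.
Set Implicit Arguments.
Unset Strict Implicit.
Context {R : realType}.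

(** Removing the factor [t ^ j] from the mass of a cylinder ended at [(2j + k, k)]
turns the recursion for the masses into this one. At [t = l (1 - l)] the value is
[(l^(k+1) - (1-l)^(k+1)) / (2l - 1)], a form which breaks down at [l = 1/2],
whereas the recursion covers all parameters at once and is visibly measurable in
[l]. *)
Fixpoint chain_poly (t : R) k : R :=
  if k is (k'.+1 as k1).+1 then chain_poly t k1 - t * chain_poly t k' else 1.

(** A first order recursion, with nonnegative terms when [0 <= l <= 1]; it yields
positivity as well as both closed forms. *)
Lemma chain_polyS (l : R) k : chain_poly (l * (1 - l)) k.+1 =
  l * chain_poly (l * (1 - l)) k + (1 - l) ^+ k.+1.
Proof.
set t := l * (1 - l); elim: k => [|k ih]; first by rewrite /=; ring.
rewrite [LHS](_ : _ = chain_poly t k.+1 - t * chain_poly t k)//.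
rewrite [(1 - l) ^+ k.+2]exprS (_ : (1 - l) ^+ k.+1 = chain_poly t k.+1 - l * chain_poly t k).
  by rewrite /t; ring.
by rewrite ih; ring.
Qed.

Lemma chain_poly_gt0 (l : R) k : 2^-1 <= l <= 1 -> 0 < chain_poly (l * (1 - l)) k.
Proof.
move=> /andP[l2 l1]; elim: k => [|k ih]; first exact: ltr01.
rewrite chain_polyS ltr_pwDl//; last by rewrite exprn_ge0// subr_ge0.
by rewrite mulr_gt0//; lra.
Qed.

Lemma chain_poly_half k : chain_poly (2^-1 * (1 - 2^-1)) k = k.+1%:R / 2 ^+ k.
Proof.
elim: k => [|k ih]; first by rewrite expr0 divr1.
rewrite chain_polyS ih -[k.+2%:R]natr1 (_ : 1 - 2^-1 = 2^-1); last by field.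
rewrite exprVn !exprS; field.
by rewrite expf_neq0.
Qed.

Lemma chain_poly_neq_half (l : R) k : (1 - 2 * l) * chain_poly (l * (1 - l)) k =
  (1 - l) ^+ k.+1 - l ^+ k.+1.
Proof.
elim: k => [|k ih]; first by rewrite /=; ring.
rewrite chain_polyS mulrDr mulrCA ih !exprS; ring.
Qed.

Lemma up_prob_chain_poly (l : R) s : 2^-1 <= l <= 1 ->
  up_prob l s = chain_poly (l * (1 - l)) s.+1 / chain_poly (l * (1 - l)) s.
Proof.
move=> l01; rewrite /up_prob; case: eqVneq => [->|lN].
  rewrite !chain_poly_half exprS; field.
  by rewrite expf_neq0// addrC natr1 pnatr_eq0.
have l2 : 1 - 2 * l != 0 by apply: contra_neq lN => h; lra.
have D0 : chain_poly (l * (1 - l)) s != 0 by rewrite gt_eqF// chain_poly_gt0.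
by rewrite -!chain_poly_neq_half invfM mulrACA divff ?mul1r.
Qed.

Lemma measurable_chain_poly k : measurable_fun setT (fun t : R => chain_poly t k).
Proof.
suff [] : measurable_fun setT (fun t : R => chain_poly t k) /\
          measurable_fun setT (fun t : R => chain_poly t k.+1) by [].
elim: k => [|k [ih ih']]; first by split; exact: measurable_cst.
split => //; apply: measurable_funB => //.
by apply: measurable_funM => //; exact: measurable_id.
Qed.

Section chain_law.
Variables (l : R) (P : probability ballot_space R).
Hypotheses (l01 : 2^-1 <= l <= 1) (P_law : is_chain_law l P).

Lemma chain_law_rcons w k : fine (P (cylinder (rcons w k))) =
  fine (P (cylinder w)) * transition_prob l (last 0%N w) k.
Proof.
have sub : cylinder (rcons w k) `<=` cylinder w by move=> x /cylinder_rcons[].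
have [P0|P0] := eqVneq (P (cylinder w)) 0%E.
  rewrite P0 mul0r (_ : P _ = 0%E)//.
  by apply: (@subset_measure0 _ _ _ P _ (cylinder w)) => //; exact: measurable_cylinder.
rewrite -P_law// /cond_prob (_ : _ `&` _ = cylinder (rcons w k)); last exact/setIidPl.
by rewrite mulrC divfK// fine_eq0// fin_num_measure//; exact: measurable_cylinder.
Qed.

Lemma chain_law_cylinder w j : path ballot_step 0%N w ->
  size w = (j.*2 + last 0%N w)%N ->
  P (cylinder w) = ((l * (1 - l)) ^+ j * chain_poly (l * (1 - l)) (last 0%N w))%:E.
Proof.
set t := l * (1 - l) => pw wj.
rewrite -[LHS]fineK; last by rewrite fin_num_measure//; exact: measurable_cylinder.
congr (_%:E); elim/last_ind: w j pw wj => [|w k ih] j.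
  by case: j => // _ _; rewrite cylinder_nil probability_setT /= mul1r.
rewrite rcons_path size_rcons last_rcons chain_law_rcons => /andP[pw].
have [i wi] := parity_path pw.
have D0 n : chain_poly t n != 0 by rewrite gt_eqF// chain_poly_gt0.
rewrite (ih i)// wi /transition_prob up_prob_chain_poly// -/t.
rewrite /ballot_step; case: eqVneq => [-> _ ij|_ /orP[//|/eqP wk]].
  have -> : j = i by lia.
  by rewrite -mulrA; congr (_ * _); rewrite mulrC divfK.
rewrite wk eqxx => ij; have -> : j = i.+1 by lia.
have := D0 k.+1; rewrite [chain_poly t k.+2](_ : _ = chain_poly t k.+1 - t * chain_poly t k)//.
by move=> Dk; rewrite exprS; field.
Qed.

End chain_law.
End chain_masses.

Section central_masses.
Set Implicit Arguments.
Unset Strict Implicit.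
Context {R : realType}.
Variable M : probability ballot_space R.
Hypothesis M_central : central M.
Variable T : ballot_space -> R.
Hypothesis bT : bounded_measurable T.
Hypothesis TP : forall j, \int[M]_x (T x ^+ j) = fine (M (cylinder (standard_path j 0))).

Lemma bounded_measurable_chain_poly k :
  bounded_measurable (fun x => chain_poly (T x) k).
Proof.
suff [] : bounded_measurable (fun x => chain_poly (T x) k) /\
          bounded_measurable (fun x => chain_poly (T x) k.+1) by [].
elim: k => [|k [ih ih']]; first by split; exact: bounded_measurable_cst.
by split => //; apply: bounded_measurableB => //; exact: bounded_measurableM.
Qed.

(** The masses of a central measure at height [k+1] follow from those at heights
[k] and [k-1], so the moments at height [0] determine them all; the integrals on
the right obey the same recursion. *)
Lemma central_cylinder w j : path ballot_step 0%N w ->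
  size w = (j.*2 + last 0%N w)%N ->
  fine (M (cylinder w)) = \int[M]_x (T x ^+ j * chain_poly (T x) (last 0%N w)).
Proof.
have [phi phiP] := central_mass M_central.
have phiE i k : phi (i.*2 + k)%N k = fine (M (cylinder (standard_path i k))).
  by rewrite phiP ?path_standard_path// size_standard_path last_standard_path.
move=> pw wj; rewrite phiP// wj; move: (last 0%N w) => k {w pw wj}.
have split i k' : phi (i.*2 + k')%N k' =
    phi (i.*2 + k'.+1)%N k'.+1 + (if k' is k''.+1 then phi (i.+1.*2 + k'')%N k'' else 0).
  have mass v : fine (M (cylinder v)) = \int[M]_(x in cylinder v) 1.
    by rewrite Rintegral_cst ?mul1r//; exact: measurable_cylinder.
  rewrite phiE mass Rintegral_cylinder_split; last 2 first.
  - exact: bounded_measurable_cst.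
  - exact: path_standard_path.
  rewrite last_standard_path -standard_pathS -mass -phiE; congr (_ + _).
  case: k' => // k'; rewrite -mass phiP ?size_rcons ?last_rcons ?size_standard_path.
    by congr phi; rewrite doubleS; lia.
  by rewrite rcons_path path_standard_path last_standard_path /ballot_step eqxx orbT.
have bTX i := bounded_measurableX i bT.
have int i k' : M.-integrable setT (EFin \o (fun x => T x ^+ i * chain_poly (T x) k')).
  apply: integrable_bounded_measurable => //; apply: bounded_measurableM => //.
  exact: bounded_measurable_chain_poly.
have P0 i : phi (i.*2 + 0)%N 0%N = \int[M]_x (T x ^+ i * chain_poly (T x) 0).
  by rewrite phiE -TP; apply: eq_Rintegral => x _; rewrite mulr1.
suff [] : (forall i, phi (i.*2 + k)%N k = \int[M]_x (T x ^+ i * chain_poly (T x) k)) /\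
     (forall i, phi (i.*2 + k.+1)%N k.+1 = \int[M]_x (T x ^+ i * chain_poly (T x) k.+1)).
  by move=> H _; exact: H.
elim: k => [|k [ih ih']].
  by split => // i; have := split i 0%N; rewrite addr0 P0.
split => // i; have := split i k.+1; rewrite ih' ih.
move=> /(canLR (addrK _)) <-; rewrite -RintegralB//.
by apply: eq_Rintegral => x _ /=; rewrite exprS; ring.
Qed.
End central_masses.

(** * Mixtures *)

Section mixing.
Set Implicit Arguments.
Unset Strict Implicit.
Context {R : realType}.

Lemma measurable_half_one : measurable (half_one : set (measurableTypeR R)).
Proof. exact: measurable_itv. Qed.

Variables (nu : R -> probability ballot_space R) (M : probability ballot_space R).
Variable mu : probability (measurableTypeR R) R.

Definition mixing_of (A : set ballot_space) :=
  measurable_fun half_one (nu^~ A : measurableTypeR R -> \bar R) /\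
  M A = (\int[mu]_(l in half_one) nu l A)%E.

(** The cylinders are closed under intersection, the empty set being the cylinder
of a sequence that is not a ballot path, and the sets on which the mixture
formula holds form a Dynkin class. Measurability of [nu^~ A] has to be carried
along, since it is known beforehand on cylinders only. *)
Lemma mixing_of_cylinders : mu half_one = 1%E ->
  (forall w, mixing_of (cylinder w)) ->
  forall A, measurable A -> mixing_of A.
Proof.
move=> mu1 cyl A mA; have mh := measurable_half_one.
apply: (@dynkin_induction _ ballot_space (range cylinder) mixing_of) => //.
- exact: setI_closed_cylinder.
- by rewrite -cylinder_nil.
- by move=> _ [w _ <-].
- move=> B mB [mnu MB].
  have nuC : (fun l => nu l (~` B)) = (fun l => 1 - nu l B)%E.
    by apply/funext => l; rewrite probability_setC.
  split.
    rewrite /mixing_of nuC; apply: emeasurable_funB => //; exact: measurable_cst.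
  rewrite probability_setC// MB nuC integralB//.
  + by congr (_ - _)%E; rewrite integral_cst// mul1e; exact/esym.
  + by apply/integrableP; split; [exact: measurable_cst|];
      under eq_integral do rewrite abse1; rewrite integral_cst// mul1e ltey_eq fin_num_measure.
  + apply/integrableP; split => //.
    under eq_integral do rewrite gee0_abs//.
    by rewrite -MB ltey_eq fin_num_measure.
- move=> F mF tF mixF.
  have nuU : (fun l => nu l (\bigcup_k F k)) = (fun l => \sum_(k <oo) nu l (F k))%E.
    by apply/funext => l; rewrite measure_bigcup//; apply: eq_eseriesl => k; rewrite in_setT.
  split.
    rewrite nuU; apply: ge0_emeasurable_sum => // k _.
    by case: (mixF k).
  rewrite nuU integral_nneseries//; last by move=> k; case: (mixF k).
  transitivity (\sum_(k <oo) M (F k))%E.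
    by rewrite measure_bigcup//; apply: eq_eseriesl => k; rewrite in_setT.
  by apply: eq_eseriesr => k _; case: (mixF k).
Qed.

End mixing.

Theorem theorem4p1 (R : realType)
    (nu : R -> probability ballot_space R)
    (nu_law : forall l : R, 2^-1 <= l <= 1 -> is_chain_law l (nu l))
    (M : probability ballot_space R) (M_central : central M) :
  exists mu : probability (measurableTypeR R) R,
    mu half_one = 1%E /\
    forall A : set ballot_space, measurable A ->
      measurable_fun half_one (nu^~ A : measurableTypeR R -> \bar R) /\
      M A = (\int[mu]_(l in half_one) nu l A)%E.
Proof.
have [L [mL L01 LP]] := exists_limit_parameter M_central.
pose L' : ballot_space -> measurableTypeR R := L.
have mL' : measurable_fun setT L' by exact: mL.
pose X : {mfun ballot_space >-> measurableTypeR R} := mfun_Sub (f := L') (mem_set mL').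
pose mu : probability (measurableTypeR R) R := distribution M X.
have LT : L @^-1` half_one = setT.
  by apply/seteqP; split => // x _; rewrite /half_one/= in_itv/= L01.
have mu1 : mu half_one = 1%E.
  transitivity (M (L @^-1` half_one)) => //.
  by rewrite LT probability_setT.
exists mu; split => // A; apply: mixing_of_cylinders => // w.
have mh := @measurable_half_one R.
have [pw|npw] := boolP (path ballot_step 0%N w); last first.
  rewrite cylinder_path//; split.
    rewrite (_ : (fun l => _) = cst 0%E); first exact: measurable_cst.
    by apply/funext => l; rewrite measure0.
  by under eq_integral do rewrite measure0; rewrite integral0 measure0.
have [j wj] := parity_path pw.
pose q (l : R) := (l * (1 - l)) ^+ j * chain_poly (l * (1 - l)) (last 0%N w).
have nuq : {in half_one, (fun l => nu l (cylinder w)) =1 (fun l => (q l)%:E)}.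
  move=> l; rewrite inE /half_one/= in_itv/= => l01.
  exact: chain_law_cylinder (nu_law l l01) _ _ _ _.
have mid : measurable_fun setT (id : R -> R) by exact: measurable_id.
have mt : measurable_fun setT (fun l : R => l * (1 - l)).
  by apply: measurable_funM => //; apply: measurable_funB => //; exact: measurable_cst.
have mq : measurable_fun setT q.
  apply: measurable_funM; first exact: measurable_funX.
  exact: (measurableT_comp (measurable_chain_poly _) mt).
have mnu : measurable_fun half_one (nu^~ (cylinder w) : measurableTypeR R -> \bar R).
  apply: (eq_measurable_fun (fun l => (q l)%:E)).
    by move=> l lh; rewrite nuq.
  by apply/measurable_EFinP; exact: measurable_funTS.
split=> //.
have -> : (\int[mu]_(l in half_one) nu l (cylinder w))%E =
    (\int[M]_(x in L @^-1` half_one) nu (L x) (cylinder w))%E.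
  exact: (ge0_integral_pushforward mL' M mh mnu).
rewrite LT (eq_integral (fun x => (q (L x))%:E)); last first.
  by move=> x _; apply: nuq; rewrite inE /half_one/= in_itv/= L01.
have bL : bounded_measurable L.
  by split=> //; exists 1 => x; have /andP[? ?] := L01 x; rewrite ger0_norm//; lra.
have bT : bounded_measurable (fun x => L x * (1 - L x)).
  apply: bounded_measurableM => //; apply: bounded_measurableB => //.
  exact: bounded_measurable_cst.
rewrite -[LHS]fineK; last by rewrite fin_num_measure//; exact: measurable_cylinder.
rewrite (central_cylinder M_central bT LP pw wj) fineK//.
apply: integrable_fin_num => //; apply: integrable_bounded_measurable => //.
apply: bounded_measurableM; first exact: bounded_measurableX.
exact: bounded_measurable_chain_poly.
Qed.
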